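(* Let $2\le k\le n-2$ and let $T\in\mathfrak{T}_{n,k}$, i.e. $T$ is a tree on $n$ vertices with exactly $k$ pendant vertices. Then $W(T_{n,k})\le W(T)$, and equality holds if and only if $T=T_{n,k}$.
   Context: Equality of graphs means isomorphism. The Wiener index of a connected graph $G$ is $W(G)=\sum_{\{u,v\}\subseteq V(G)}d_G(u,v)$, where the sum is over unordered pairs of vertices and $d_G$ is the shortest-path distance. A pendant vertex is a vertex of degree one. $\mathfrak{T}_{n,k}$ is the class of all trees on $n$ vertices with exactly $k$ pendant vertices. $P_m$ denotes the path on $m$ vertices. $T_{n,k}\in\mathfrak{T}_{n,k}$ is the tree that has a vertex $v$ of degree $k$ such that $T_{n,k}\setminus v = rP_{q+1}\cup (k-r)P_q$ (a disjoint union of $r$ copies of $P_{q+1}$ and $k-r$ copies of $P_q$), where $q=\lfloor\frac{n-1}{k}\rfloor$ and $r=n-1-kq$, so $0\le r<k$. *)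

(* Defs.v *)
From mathcomp Require Import all_boot.

Set Implicit Arguments.
Unset Strict Implicit.
Unset Printing Implicit Defensive.

Record sgraph := SGraph {
  vertex :> finType;
  adj : rel vertex;
  adj_sym : symmetric adj;
  adj_irrefl : irreflexive adj
}.

Definition iso (G H : sgraph) : Prop :=
  exists f : G -> H, bijective f /\ forall x y, adj (f x) (f y) = adj x y.

Definition degree (G : sgraph) (x : G) : nat := #|[set y | adj x y]|.

Definition pendant (G : sgraph) : {set G} := [set x | degree x == 1].

Definition connected (G : sgraph) : Prop :=
  0 < #|G| /\ forall x y : G, connect (@adj G) x y.

(* [cycle] accepts [:: x; y] for every edge xy, hence the bound on the size. *)
Definition acyclic (G : sgraph) : Prop :=
  forall c : seq G, uniq c -> 2 < size c -> ~~ cycle (@adj G) c.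

Definition is_tree (G : sgraph) : Prop := connected G /\ acyclic G.

Definition tree_class (n k : nat) (G : sgraph) : Prop :=
  [/\ is_tree G, #|G| = n & #|pendant G| = k].

(* The least number of edges of a walk from x to y; the value is #|G| if there
   is no such walk.  See [dist_le] and [dist_walk]. *)
Definition dist (G : sgraph) (x y : G) : nat :=
  find (fun m => [exists p : m.-tuple G,
                    path (@adj G) x p && (last x p == y)])
       (iota 0 #|G|).

(* Comparing ranks in the enumeration of G picks each unordered pair of distinct
   vertices exactly once; [dist] is symmetric, so the orientation is
   irrelevant. *)
Definition wiener (G : sgraph) : nat :=
  \sum_(u : G) \sum_(v : G | enum_rank u < enum_rank v) dist u v.

Section Constructions.

Definition path_rel (m : nat) : rel 'I_m :=
  fun i j => (i.+1 == j) || (j.+1 == i).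

Lemma path_rel_sym m : symmetric (@path_rel m).
Proof. by move=> i j; rewrite /path_rel orbC. Qed.

Lemma path_rel_irrefl m : irreflexive (@path_rel m).
Proof. by move=> i; rewrite /path_rel orbb gtn_eqF. Qed.

Definition path_graph (m : nat) : sgraph :=
  SGraph (@path_rel_sym m) (@path_rel_irrefl m).

Definition union_rel (G H : sgraph) : rel (G + H) := fun x y =>
  match x, y with
  | inl a, inl b => adj a b
  | inr a, inr b => adj a b
  | _, _ => false
  end.

Lemma union_rel_sym G H : symmetric (@union_rel G H).
Proof. by move=> [a|a] [b|b] //=; rewrite adj_sym. Qed.

Lemma union_rel_irrefl G H : irreflexive (@union_rel G H).
Proof. by move=> [a|a] /=; rewrite adj_irrefl. Qed.

Definition disjoint_union (G H : sgraph) : sgraph :=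
  SGraph (@union_rel_sym G H) (@union_rel_irrefl G H).

Definition copies_rel (m : nat) (G : sgraph) : rel ('I_m * G) :=
  fun x y => (x.1 == y.1) && adj x.2 y.2.

Lemma copies_rel_sym m G : symmetric (@copies_rel m G).
Proof. by move=> x y; rewrite /copies_rel eq_sym adj_sym. Qed.

Lemma copies_rel_irrefl m G : irreflexive (@copies_rel m G).
Proof. by move=> x; rewrite /copies_rel adj_irrefl andbF. Qed.

Definition copies (m : nat) (G : sgraph) : sgraph :=
  SGraph (@copies_rel_sym m G) (@copies_rel_irrefl m G).

Definition delete_rel (G : sgraph) (v : G) : rel {x : G | x != v} :=
  fun x y => adj (val x) (val y).

Lemma delete_rel_sym (G : sgraph) (v : G) : symmetric (delete_rel (v := v)).
Proof. by move=> x y; rewrite /delete_rel adj_sym. Qed.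

Lemma delete_rel_irrefl (G : sgraph) (v : G) :
  irreflexive (delete_rel (v := v)).
Proof. by move=> x; rewrite /delete_rel adj_irrefl. Qed.

Definition delete_vertex (G : sgraph) (v : G) : sgraph :=
  SGraph (@delete_rel_sym G v) (@delete_rel_irrefl G v).

End Constructions.

(* Determines S up to isomorphism; existence is [is_Tnk_exists]. *)
Definition is_Tnk (n k : nat) (S : sgraph) : Prop :=
  let q := (n - 1) %/ k in
  let r := n - 1 - k * q in
  tree_class n k S /\
  exists v : S, degree v = k /\
    iso (delete_vertex v)
        (disjoint_union (copies r (path_graph q.+1))
                        (copies (k - r) (path_graph q))).

Section DistanceFacts.
Variable G : sgraph.
Implicit Types x y : G.

Lemma dist_le x y (p : seq G) :
  path (@adj G) x p -> last x p = y -> dist x y <= size p.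
Proof.
move=> xp lp; rewrite /dist.
set P := (X in find X _); rewrite leqNgt; apply/negP => lt.
have ltG : size p < #|G|.
  by have := leq_trans lt (find_size P (iota 0 #|G|)); rewrite size_iota.
have /negbT/negP[] := before_find 0 lt; rewrite nth_iota // add0n.
by apply/existsP; exists (in_tuple p); rewrite xp lp eqxx.
Qed.

Lemma dist_walk x y : connect (@adj G) x y ->
  exists p : seq G, [/\ path (@adj G) x p, last x p = y & size p = dist x y].
Proof.
move=> /connectP[p0 xp0 ->]; case/shortenP: xp0 => p xp Up _.
set y' := last x p; rewrite /dist; set P := (X in find X _).
have ltG : size p < #|G| by rewrite -[(size p).+1]/(size (x :: p)) -(card_uniqP Up) max_card.
have hasP : has P (iota 0 #|G|).
  apply/hasP; exists (size p); first by rewrite mem_iota.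
  by apply/existsP; exists (in_tuple p); rewrite xp eqxx.
have := nth_find 0 hasP; rewrite nth_iota; last by rewrite -[ltnRHS](size_iota 0) -has_find.
rewrite add0n => /existsP[t /andP[xt /eqP lt]].
by exists t; rewrite size_tuple.
Qed.

End DistanceFacts.

Section Existence.
Variables q r s : nat.

Let H := disjoint_union (copies r (path_graph q.+2))
                        (copies s (path_graph q.+1)).

Let pos (x : H) : nat :=
  match x with inl a => val a.2 | inr a => val a.2 end.

Let spider_rel : rel (option H) := fun x y =>
  match x, y with
  | Some a, Some b => adj a b
  | None, Some a | Some a, None => pos a == 0
  | None, None => false
  end.

Let spider_sym : symmetric spider_rel.
Proof. by move=> [a|] [b|] //=; exact: (@adj_sym H). Qed.

Let spider_irrefl : irreflexive spider_rel.
Proof. by move=> [a|] //=; exact: (@adj_irrefl H). Qed.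

Let spider : sgraph := SGraph spider_sym spider_irrefl.

Let depth (x : spider) : nat := if x is Some a then (pos a).+1 else 0.

Let pred_ord m (i : 'I_m) : 'I_m :=
  Ordinal (leq_ltn_trans (leq_pred i) (ltn_ord i)).

Let parent (x : spider) : spider :=
  match x with
  | Some (inl a) => if val a.2 == 0 then None
                    else Some (inl (a.1, pred_ord a.2))
  | Some (inr a) => if val a.2 == 0 then None
                    else Some (inr (a.1, pred_ord a.2))
  | None => None
  end.

Let parent_adj (x : spider) : 0 < depth x -> adj x (parent x).
Proof.
case: x => [[[i [[|a] lta]]|[i [[|a] lta]]]|] //= _;
by apply/andP; rewrite /= eqxx; split=> //; apply/orP; right; apply/eqP.
Qed.

Let parent_depth (x : spider) : 0 < depth x -> depth (parent x) < depth x.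
Proof. by case: x => [[[i [[|a] lta]]|[i [[|a] lta]]]|]. Qed.

Let adj_parent (x y : spider) : adj x y -> depth y <= depth x -> y = parent x.
Proof.
case: x => [[[i [a lta]]|[i [a lta]]]|];
case: y => [[[j [b ltb]]|[j [b ltb]]]|] //=; try (by move=> ->);
rewrite /copies_rel /path_rel /= => /andP[/eqP-> /orP[]/eqP/= e] le;
first [by rewrite -e ltnn in le
   | case: a lta e le => [|a] lta // [e] _ /=;
     by rewrite (_ : Ordinal ltb = pred_ord (Ordinal lta)) //; apply: val_inj].
Qed.

Let spider_connected : connected spider.
Proof.
split; first by apply/card_gt0P; exists None.
have csym : connect_sym (@adj spider).
  by apply: sym_connect_sym; exact: adj_sym.
have toN (x : spider) : connect (@adj spider) x None.
  move: {2}(depth x) (leqnn (depth x)) => d.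
  elim: d x => [|d IH] x; first by case: x.
  case: (posnP (depth x)) => [x0 _|x0 xd]; first by case: x x0.
  apply: connect_trans (connect1 (parent_adj x0)) (IH _ _).
  by rewrite -ltnS; apply: leq_trans (parent_depth x0) xd.
by move=> x y; apply: connect_trans (toN x) _; rewrite csym.
Qed.

Let spider_acyclic : acyclic spider.
Proof.
move=> c Uc c3; apply/negP => cyc.
have [x0 cx0] : exists x, x \in c.
  by case: c c3 {Uc cyc} => // x c _; exists x; rewrite mem_head.
case: (arg_maxnP depth cx0) => x cx xmax.
have [i p def] := rot_to cx.
have dp y : y \in p -> depth y <= depth x.
  by move=> py; apply: xmax; rewrite -[_ y]/(y \in c) -(mem_rot i) def inE py orbT.
move: cyc Uc c3; rewrite -(rot_cycle i) -(rot_uniq i) -(size_rot i) def /=.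
case/lastP: p dp {def} => // p z dp.
rewrite !rcons_path last_rcons => /andP[pth zx] /andP[_ Up] sz.
have ez : z = parent x.
  by apply: adj_parent; [rewrite adj_sym | rewrite dp // mem_rcons mem_head].
case: p dp pth Up sz => // y p dp /= /andP[/andP[xy _] _] Up _.
have ey : y = parent x by apply: adj_parent => //; rewrite dp ?mem_head.
by move: Up; rewrite ey ez mem_rcons mem_head.
Qed.

Let leaf (x : 'I_r + 'I_s) : spider :=
  match x with
  | inl i => Some (inl (i, ord_max))
  | inr i => Some (inr (i, ord_max))
  end.

Let top (x : 'I_r + 'I_s) : spider :=
  match x with
  | inl i => Some (inl (i, ord0))
  | inr i => Some (inr (i, ord0))
  end.

Let degree_center : degree (None : spider) = r + s.
Proof.
have top_inj : injective top by move=> [i|i] [j|j] // [->].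
rewrite /degree -(card_ord r) -(card_ord s) -card_sum.
rewrite -(card_imset _ top_inj).
apply: eq_card => x; rewrite inE; apply/idP/imsetP => [|[[i|i] _ ->]] //.
case: x => [[[i a]|[i a]]|] //= a0; [exists (inl i) | exists (inr i)] => //=;
by rewrite (_ : a = ord0) //; apply: val_inj; apply/eqP.
Qed.

Let child_ex (x : H) : (Some x : spider) \notin [set leaf i | i in predT] ->
  exists2 y : spider, adj (Some x : spider) y & depth y = (pos x).+2.
Proof.
case: x => [[i a]|[i a]] nl.
  have lta : a < q.+1.
    rewrite ltn_neqAle -ltnS ltn_ord andbT; apply: contra nl => ea.
    apply/imsetP; exists (inl i) => //=.
    by rewrite (_ : a = ord_max) //; apply: val_inj; apply/eqP.
  by exists (Some (inl (i, Ordinal (lta : a.+1 < q.+2))));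
    [apply/andP; rewrite /= eqxx /path_rel /= eqxx |].
have lta : a < q.
  rewrite ltn_neqAle -ltnS ltn_ord andbT; apply: contra nl => ea.
  apply/imsetP; exists (inr i) => //=.
  by rewrite (_ : a = ord_max) //; apply: val_inj; apply/eqP.
by exists (Some (inr (i, Ordinal (lta : a.+1 < q.+1))));
  [apply/andP; rewrite /= eqxx /path_rel /= eqxx |].
Qed.

Let leaf_adj i (y : spider) : adj (leaf i) y -> depth y <= depth (leaf i).
Proof.
case: i => i; case: y => [[[j b]|[j b]]|] //=;
by rewrite /copies_rel /path_rel /= => _; rewrite ltn_ord.
Qed.

Let card_pendant : 1 < r + s -> #|pendant spider| = r + s.
Proof.
move=> rs; have leaf_inj : injective leaf by move=> [i|i] [j|j] // [->].
have -> : r + s = #|{: 'I_r + 'I_s}| by rewrite card_sum !card_ord.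
rewrite -(card_imset _ leaf_inj); apply: eq_card => x; rewrite inE.
case lx : (x \in _).
  case/imsetP: lx => i _ ->.
  apply/cards1P; exists (parent (leaf i)); apply/setP => y; rewrite !inE.
  apply/idP/eqP => [xy|->]; first by apply: adj_parent (leaf_adj xy).
  by apply: parent_adj; case: i.
case: x lx => [x|] /negbT lx; last first.
  by rewrite degree_center; apply: gtn_eqF.
have [y xy dy] := child_ex lx.
apply: gtn_eqF; have ne : y != parent (Some x).
  apply/eqP => e; have := @parent_depth (Some x) isT.
  by rewrite -e dy /= ltnNge leqnSn.
apply: leq_trans (_ : #|[set y; parent (Some x)]| <= _).
  by rewrite cards2 ne.
apply: subset_leq_card; apply/subsetP => z; rewrite !inE.
by case/orP => /eqP-> //; apply: parent_adj.
Qed.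

Let delete_center : iso (delete_vertex (None : spider)) H.
Proof.
have val_ex (x : delete_vertex (None : spider)) : {y : H | val x = Some y}.
  by case: x => [[y|] //= _]; exists y.
exists (fun x => sval (val_ex x)); split => [|x y].
  exists (fun y : H => exist _ (Some y) isT : delete_vertex (None : spider)).
    by move=> x; apply: val_inj; case: (val_ex x).
  by move=> y; case: (val_ex _) => z /= [->].
by case: (val_ex x) (val_ex y) => a ea [b eb] /=; rewrite /delete_rel ea eb.
Qed.

Lemma spider_exists : 1 < r + s -> exists S : sgraph,
  tree_class (r * q.+2 + s * q.+1).+1 (r + s) S /\
  exists v : S, degree v = r + s /\ iso (delete_vertex v) H.
Proof.
move=> rs; exists spider; split; last by exists None.
split; [by split | | exact: card_pendant].
by rewrite card_option card_sum !card_prod !card_ord.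
Qed.

End Existence.

Lemma is_Tnk_exists (n k : nat) :
  2 <= k <= n - 2 -> exists S : sgraph, is_Tnk n k S.
Proof.
case/andP=> k2 kn; have k0 : 0 < k by apply: ltnW.
have n1 : k <= n - 1 by apply: leq_trans kn _; apply: leq_sub2l.
rewrite /is_Tnk; set q := (n - 1) %/ k; set r := n - 1 - k * q.
have : 0 < q by rewrite divn_gt0.
have e : k * q + r = n - 1 by rewrite subnKC // mulnC leq_divM.
have rk : r < k by rewrite /r mulnC {1}(divn_eq (n - 1) k) addKn ltn_pmod.
case: q @r e rk => // q r e rk _.
have kE : r + (k - r) = k by rewrite subnKC // ltnW.
have nE : (r * q.+2 + (k - r) * q.+1).+1 = n.
  rewrite mulnS -addnA -mulnDl kE addnC e subn1 prednK //.
  by move: (leq_trans k0 n1); rewrite subn_gt0; apply: ltnW.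
by have := @spider_exists q r (k - r); rewrite kE nE; apply.
Qed.

(* Main.v *)
(* Root T at a vertex c, and let the weight of x be its number of descendants.  An
   edge from x to its parent separates weight x * (n - weight x) pairs, so W(T) is
   the sum of these products over x != c; if c is a centroid, no such weight exceeds
   n/2, and W(T) = sum_j (n - 1 - 2j) C_j, where C_j counts the x != c of weight
   greater than j.  Vertices of equal weight are pairwise incomparable and each lies
   above its own leaf, so at most k of them share a weight; hence
   C_j >= n - 1 - k j.  Equality for all j forces every x != c to have at most one
   child, and then the depths of the leaves, hence T, are determined by n and k.
   The tree T_{n,k}, rooted at its vertex of degree k, attains all these bounds. *)

Require Import Defs.
From mathcomp Require Import all_boot.
From mathcomp Require Import zify.

Set Implicit Arguments.
Unset Strict Implicit.
Unset Printing Implicit Defensive.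

(** * Distances and the rooting of a tree *)

Lemma dist_refl (G : sgraph) (x : G) : dist x x = 0.
Proof. by apply/eqP; rewrite -leqn0; apply: (@dist_le G x x [::]). Qed.

Lemma dist_eq0 (G : sgraph) (x y : G) : connected G -> dist x y = 0 -> x = y.
Proof.
move=> [_ conG] d0; have [[|z p] [_ //= _]] := dist_walk (conG x y).
by rewrite d0.
Qed.

Lemma dist_adj (G : sgraph) (x y z : G) :
  connected G -> adj y z -> dist x z <= (dist x y).+1.
Proof.
move=> [_ conG] yz; have [p [xp lp <-]] := dist_walk (conG x y).
by rewrite -(size_rcons p z) dist_le ?last_rcons // rcons_path xp lp.
Qed.

Lemma dist_pred (G : sgraph) (x y : G) : connected G -> y != x ->
  exists2 z, adj z y & dist x y = (dist x z).+1.
Proof.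
move=> conG ne; have [p [xp lp sp]] := dist_walk (proj2 conG x y).
case/lastP: p xp lp sp => [|p y'] xp /=; first by move=> e; rewrite e eqxx in ne.
rewrite last_rcons size_rcons => ey sp; move: xp; rewrite ey rcons_path => /andP[xp py].
exists (last x p) => //; apply/eqP; rewrite eqn_leq (dist_adj x conG py) /=.
by rewrite -sp ltnS dist_le.
Qed.

(** Since the root is its own parent, [par] is total and ancestry is just its orbit relation. *)
Definition rooting (G : sgraph) (c : G) (par : G -> G) : Prop :=
  [/\ par c = c,
      forall x y, adj x y = (x != c) && (par x == y) || (y != c) && (par y == x)
    & forall x, x != c -> dist c x = (dist c (par x)).+1].

(** The parent is a neighbour one step closer to c. Another neighbour y of x that is no deeper than
    x would close a cycle through x, because y and the parent of x are joined via c without meeting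
    x. *)
Lemma tree_rooting (G : sgraph) (c : G) : is_tree G -> exists par, rooting c par.
Proof.
move=> [conG acG].
pose par x := odflt x [pick z | adj z x && (dist c x == (dist c z).+1)].
have parP x : x != c -> adj (par x) x /\ dist c x = (dist c (par x)).+1.
  move=> xc; rewrite /par; case: pickP => [z /andP[zx /eqP] //|no].
  by have [z zx dz] := dist_pred conG xc; have := no z; rewrite zx dz eqxx.
pose e x := [rel a b : G | [&& adj a b, a != x & b != x]].
(* Climbing from y to c strictly decreases the depth, so it never meets x. *)
have toc x y : dist c y <= dist c x -> y != x -> connect (e x) c y.
  elim: {y}(dist c y) {-2}y (leqnn (dist c y)) => [|d IH] y yd yx ne.
    by move: yd; rewrite leqn0 => /eqP/(dist_eq0 conG) ->.
  have [->//|yc] := eqVneq y c.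
  have [py dy] := parP y yc.
  have pyx : par y != x by apply/eqP => E; move: yx; rewrite dy E ltnn.
  apply: connect_trans (IH _ _ _ pyx) (connect1 _); [by rewrite dy in yd| |].
    by apply: leq_trans yx; rewrite dy.
  by rewrite /= py pyx.
have lower x y : adj x y -> dist c y <= dist c x -> x != c /\ par x = y.
  move=> xy yx.
  have xc : x != c.
    apply/eqP => E; move: yx xy; rewrite E dist_refl leqn0 => /eqP/(dist_eq0 conG) <-.
    by rewrite adj_irrefl.
  split=> //; apply/eqP; apply: contraT => ne.
  have [px dx] := parP x xc.
  have esym : connect_sym (e x).
    by apply: sym_connect_sym => a b; rewrite /= adj_sym andbA andbAC -andbA.
  have pxx : par x != x by apply/eqP => E; rewrite E adj_irrefl in px.
  have yxx : y != x by apply/eqP => E; rewrite E adj_irrefl in xy.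
  have : connect (e x) (par x) y.
    apply: connect_trans (toc x y yx yxx); rewrite esym; apply: toc pxx.
    by rewrite dx.
  case/connectP => p0 pp0; case/shortenP: pp0 => p pp Up _ ly.
  have xp : x \notin par x :: p.
    have : all (predC1 x) p.
      elim: p (par x) pp {Up ly} => //= a p IHp z /andP[/and3P[_ _ ->] /IHp].
      by [].
    rewrite inE eq_sym (negbTE pxx) /= => /allP al; apply/negP => /al /=.
    by rewrite eqxx.
  have size_c : 2 < size [:: x, par x & p].
    by case: p ly {pp Up xp} => //= E; rewrite E eqxx in ne.
  have/acG/(_ size_c)/negP[] : uniq [:: x, par x & p] by rewrite cons_uniq xp.
  rewrite /= adj_sym px rcons_path -ly adj_sym xy andbT /=.
  by apply: sub_path pp => a b /and3P[].
exists par; split=> [|x y|x xc]; last by have [] := parP x xc.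
  by rewrite /par; case: pickP => //= z; rewrite dist_refl andbF.
apply/idP/idP => [xy|/orP[]/andP[nc /eqP <-]].
- case: (leqP (dist c y) (dist c x)) => le.
    by have [-> ->] := lower x y xy le; rewrite eqxx.
  rewrite adj_sym in xy; have [-> ->] := lower y x xy (ltnW le).
  by rewrite eqxx orbT.
- by rewrite adj_sym; have [] := parP x nc.
- by have [] := parP y nc.
Qed.

(** * The Wiener index over ordered pairs *)

Lemma dist_sym (G : sgraph) (x y : G) : connected G -> dist x y = dist y x.
Proof.
move=> [_ conG].
suff le (u v : G) : dist u v <= dist v u by apply/eqP; rewrite eqn_leq !le.
have [p [vp lp <-]] := dist_walk (conG v u).
rewrite -lp -(size_belast v p) -size_rev; apply: dist_le.
  by rewrite (eq_path (@adj_sym G)) rev_path.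
by case: p {vp lp} => //= a p; rewrite rev_cons last_rcons.
Qed.

Lemma wiener_double (G : sgraph) :
  connected G -> (wiener G).*2 = \sum_(u : G) \sum_(v : G) dist u v.
Proof.
move=> conG; pose F (u v : G) := (enum_rank u < enum_rank v) * dist u v.
have WF : wiener G = \sum_(u : G) \sum_(v : G) F u v.
  apply: eq_bigr => u _; rewrite big_mkcond; apply: eq_bigr => v _.
  by rewrite /F; case: ifP => _; rewrite ?mul1n ?mul0n.
rewrite -addnn {1}WF exchange_big WF -big_split; apply: eq_bigr => u _ /=.
rewrite -big_split; apply: eq_bigr => v _ /=.
rewrite /F (dist_sym v u conG); case: ltngtP => [_|_|E];
  rewrite /= ?mul0n ?mul1n ?addn0 //.
by rewrite (enum_rank_inj (val_inj E)) dist_refl.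
Qed.

(** * Ancestry in a rooted tree *)

Section Rooted.
Variables (G : sgraph) (c : G) (par : G -> G).
Hypotheses (conG : connected G) (rt : rooting c par).

Definition below (y x : G) : bool := fconnect par y x.
Definition weight (x : G) : nat := #|[set y | below y x]|.
(** The shift by one makes [level 0] the set of leaves other than the root, and [level j] the
    difference of [upper j] and [upper j.+1]. *)
Definition level (j : nat) : {set G} := [set x | (x != c) && (weight x == j.+1)].
Definition upper (j : nat) : {set G} := [set x | (x != c) && (j < weight x)].
(** The root is excluded because [leaf_exists] provides a leaf only below the other vertices. *)
Definition antichain (A : {set G}) : Prop :=
  c \notin A /\ {in A &, forall x y, below x y -> x = y}.

Lemma par_root : par c = c. Proof. by case: rt. Qed.

Lemma adjE x y : adj x y = (x != c) && (par x == y) || (y != c) && (par y == x).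
Proof. by case: rt. Qed.

Lemma depth_par x : dist c (par x) = (dist c x).-1.
Proof.
case: rt => pc _ dp; have [->|/dp ->//] := eqVneq x c.
by rewrite pc dist_refl.
Qed.

(** Truncated subtraction accounts for the iterates that stay at the root. *)
Lemma depth_iter i x : dist c (iter i par x) = dist c x - i.
Proof. by elim: i => [|i IH] /=; rewrite ?subn0 // depth_par IH subnS. Qed.

Lemma depth_gt0 x : (0 < dist c x) = (x != c).
Proof.
apply/idP/idP; first by apply: contraTneq => ->; rewrite dist_refl.
by rewrite lt0n; apply: contraNneq => /(dist_eq0 conG) ->.
Qed.

Lemma iter_root i x : (iter i par x == c) = (dist c x <= i).
Proof. by apply: negb_inj; rewrite -depth_gt0 depth_iter subn_gt0 ltnNge. Qed.

Lemma below_refl x : below x x. Proof. exact: connect0. Qed.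

Lemma below_trans x y z : below x y -> below y z -> below x z.
Proof. exact: connect_trans. Qed.

Lemma below_par x : below x (par x). Proof. exact: fconnect1. Qed.

Lemma below_iter i x : below x (iter i par x). Proof. exact: fconnect_iter. Qed.

Lemma belowP x y : below x y -> exists i, y = iter i par x.
Proof. by move=> xy; exists (findex par x y); rewrite iter_findex. Qed.

Lemma below_neq x y : x != y -> below x y = below (par x) y.
Proof. by move=> xy; rewrite /below fconnect_eqVf (negbTE xy). Qed.

Lemma below_depth x y : below x y -> dist c y <= dist c x.
Proof. by move=> /belowP[i ->]; rewrite depth_iter leq_subr. Qed.

Lemma root_below x : below c x -> x = c.
Proof.
by move/below_depth; rewrite dist_refl leqn0 => /eqP/(dist_eq0 conG).
Qed.

Lemma below_nroot x y : below x y -> y != c -> x != c.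
Proof. by move=> xy; apply: contraNneq => xc; rewrite xc in xy; apply/eqP/root_below. Qed.

Lemma below_depth_eq x y : below x y -> dist c x <= dist c y -> x = y.
Proof.
move=> xy le; have [//|xy'] := eqVneq x y.
have [xc|xc] := eqVneq x c; first by rewrite xc (@root_below y) // -xc.
have := below_depth (y := y) (x := par x); rewrite -below_neq // depth_par => /(_ xy).
by move: xc; rewrite -depth_gt0; lia.
Qed.

(** The ancestors of z are the iterates of [par] at z, so they form a chain. *)
Lemma below_total z x y : below z x -> below z y -> below x y || below y x.
Proof.
move=> /belowP[i ->] /belowP[j ->].
case/orP: (leq_total i j) => le; apply/orP; [left|right];
by rewrite -(subnK le) iterD below_iter.
Qed.

Lemma par_not_below x : x != c -> ~~ below (par x) x.
Proof.
by move=> xc; apply/negP => /below_depth; move: xc; rewrite depth_par -depth_gt0; lia.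
Qed.

(** * Distance as a number of separating edges *)

(** Each edge is represented by its lower end x; removing it separates u from v exactly when one of
    the two lies below x. *)
Definition sep (u v : G) : nat := \sum_(x | x != c) (below u x (+) below v x).

(** Replacing v by its parent affects only the term of v itself, which changes by one in a direction
    given by [below u v]; the doubled term avoids a subtraction. *)
Lemma sep_par u v : v != c -> sep u v + (below u v).*2 = (sep u (par v)).+1.
Proof.
move=> vc; rewrite /sep !(bigD1 v vc) /= below_refl (negbTE (par_not_below vc)).
rewrite (eq_bigr (fun x => nat_of_bool (below u x (+) below (par v) x))).
  by case: (below u v) => /=; lia.
by move=> x /andP[_ xv]; rewrite (below_neq (x := v)) // eq_sym.
Qed.

Lemma sep_sym u v : sep u v = sep v u.
Proof. by apply: eq_bigr => x _; rewrite addbC. Qed.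

Lemma sep_adj u x y : adj x y -> sep u y <= (sep u x).+1.
Proof.
rewrite adjE => /orP[]/andP[nc /eqP <-]; have := sep_par u nc; lia.
Qed.

(** A step along a walk changes [sep] by at most one, so [sep] is a lower bound. For the other
    inequality, move the deeper of two distinct vertices to its parent: the other one is not below
    it, so [sep] drops by exactly one. *)
Lemma distE u v : dist u v = sep u v.
Proof.
apply/eqP; rewrite eqn_leq; apply/andP; split; last first.
  have [p [up <- <-]] := dist_walk (proj2 conG u v).
  elim/last_ind: p up => [|p y IH] /=.
    by rewrite /sep big1 // => x _; rewrite addbb.
  rewrite rcons_path last_rcons size_rcons => /andP[/IH le /(sep_adj u)].
  by move/leq_trans; apply.
elim: {u v}(dist c u + dist c v) {-2}u {-2}v (leqnn (dist c u + dist c v)) => [|d IH] u v.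
  rewrite leqn0 addn_eq0 => /andP[/eqP/(dist_eq0 conG) <- /eqP/(dist_eq0 conG) <-].
  by rewrite dist_refl.
wlog le : u v / dist c u <= dist c v.
  move=> H; case/orP: (leq_total (dist c u) (dist c v)) => le d1; first exact: H.
  by rewrite dist_sym // sep_sym H // addnC.
have [->|uv] := eqVneq u v; first by rewrite dist_refl.
have vc : v != c.
  rewrite -depth_gt0; case: (posnP (dist c v)) => // v0; move: le uv.
  by rewrite v0 leqn0 => /eqP/(dist_eq0 conG) <-; rewrite (dist_eq0 conG v0) eqxx.
have uv' : below u v = false.
  by apply: contraNF uv => /below_depth_eq ->.
move=> dd; have := sep_par u vc; rewrite uv' addn0 => ->.
have /(dist_adj u conG)/leq_trans-> // : adj (par v) v by rewrite adjE vc eqxx orbT.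
by rewrite ltnS IH // depth_par; move: vc; rewrite -depth_gt0; lia.
Qed.

(** After exchanging sums, x contributes the number of ordered pairs separated by the edge above x,
    which is twice the summand. *)
Lemma wiener_weight : wiener G = \sum_(x | x != c) weight x * (#|G| - weight x).
Proof.
apply: double_inj; rewrite wiener_double // -mul2n big_distrr /=.
under eq_bigr do under eq_bigr do rewrite distE.
under eq_bigr do rewrite exchange_big /=.
rewrite exchange_big /=; apply: eq_bigr => x _.
have cardB : \sum_(v : G) below v x = weight x.
  by rewrite /weight -sum1dep_card [RHS]big_mkcond; apply: eq_bigr => v _; case: ifP.
have cardN : \sum_(v : G) ~~ below v x = #|G| - weight x.
  rewrite -cardB -sum1_card.
  rewrite -[X in _ = X - _](_ : \sum_(v : G) (below v x + ~~ below v x) = _).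
    by rewrite big_split /= addKn.
  by apply: eq_bigr => v _; case: (below v x).
rewrite (eq_bigr (fun u => below u x * (#|G| - weight x) + ~~ below u x * weight x)).
  by rewrite big_split /= -!big_distrl /= cardB cardN [X in _ + X]mulnC addnn mul2n.
move=> u _; case: (below u x) => /=; first by rewrite cardN mul1n addn0.
by rewrite cardB mul1n.
Qed.

(** * Weights, leaves and antichains *)

Lemma weight_le x y : below x y -> weight x <= weight y.
Proof.
move=> xy; apply/subset_leq_card/subsetP => z; rewrite !inE => zx.
exact: below_trans zx xy.
Qed.

Lemma weight_gt0 x : 0 < weight x.
Proof. by apply/card_gt0P; exists x; rewrite inE below_refl. Qed.

Lemma weight_lt x y : below x y -> x != y -> weight x < weight y.
Proof.
move=> xy ne; apply: proper_card; rewrite properE; apply/andP; split.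
  by apply/subsetP => z; rewrite !inE => zx; apply: below_trans zx xy.
apply/subsetPn; exists y; rewrite !inE ?below_refl //.
by apply: contra ne => yx; rewrite (below_depth_eq xy) // below_depth.
Qed.

(** A deepest vertex below x has nothing but itself below it. *)
Lemma leaf_exists x : x != c -> exists2 y, y \in level 0 & below y x.
Proof.
move=> xc; have [y yx ymax] := arg_maxnP (dist c) (below_refl x : [pred y | below y x] x).
exists y => //; rewrite inE (below_nroot yx xc) eqn_leq weight_gt0 andbT -ltnS.
rewrite ltnS /weight -(cards1 y); apply/subset_leq_card/subsetP => z; rewrite !inE => zy.
apply/eqP/below_depth_eq => //; apply: ymax; exact: below_trans zy yx.
Qed.

(** Only an inclusion, since a root of degree one is pendant too. *)
Lemma leaf_pendant : level 0 \subset pendant G.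
Proof.
apply/subsetP => x; rewrite !inE => /andP[xc /eqP wx].
rewrite /degree -(cards1 (par x)); apply/eqP; congr #|pred_of_set _|.
apply/setP => y; rewrite !inE adjE xc eq_sym /=; case: eqVneq => //= ne.
apply/negbTE/negP => /andP[yc /eqP ey]; move: (weight_gt0 y) wx.
have := @weight_lt y x; rewrite -ey below_par => /(_ isT).
case: eqVneq => [E|_ /(_ isT)]; last by lia.
by have := par_not_below yc; rewrite -E below_refl.
Qed.

(** Choosing a leaf below each member is injective, as two vertices above the same leaf are
    comparable. *)
Lemma antichain_card (A : {set G}) : antichain A -> #|A| <= #|pendant G|.
Proof.
move=> [cA acA]; apply: leq_trans (subset_leq_card leaf_pendant).
pose f x := odflt c [pick y | (y \in level 0) && below y x].
have fP x : x \in A -> f x \in level 0 /\ below (f x) x.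
  move=> xA; rewrite /f; case: pickP => [y /andP[] //|no].
  have xc : x != c by apply: contraNneq cA => <-.
  by have [y y0 yx] := leaf_exists xc; have := no y; rewrite y0 yx.
rewrite -(@card_in_imset _ _ f).
  by apply/subset_leq_card/subsetP => _ /imsetP[x /fP[? _] ->].
move=> x y xA yA E; have [_ fx] := fP x xA; have [_ fy] := fP y yA.
rewrite -E in fy; case/orP: (below_total fx fy); first exact: acA.
by move=> /acA ->.
Qed.

Lemma level_antichain j : antichain (level j).
Proof.
split=> [|x y]; rewrite !inE ?eqxx // => /andP[_ /eqP wx] /andP[_ /eqP wy] xy.
by apply/eqP; apply: contraT => /(weight_lt xy); rewrite wx wy ltnn.
Qed.

Lemma upperS j : #|upper j| = #|level j| + #|upper j.+1|.
Proof.
rewrite -(cardsID (level j) (upper j)); congr (_ + _);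
by apply: eq_card => x; rewrite !inE; case: (x != c) => //=; lia.
Qed.

Lemma upper0 : #|upper 0| = #|G| - 1.
Proof.
rewrite subn1 -(cardC1 c); by apply: eq_card => x; rewrite !inE weight_gt0 andbT.
Qed.

(** Each passage from j to j + 1 discards only [level j], an antichain. *)
Lemma upper_ge j : #|G| - 1 - #|pendant G| * j <= #|upper j|.
Proof.
elim: j => [|j IH]; first by rewrite upper0 muln0 subn0.
have := upperS j; have := antichain_card (level_antichain j); nia.
Qed.


(** * Spiders and the numbers of their legs of each length *)

(** The tree then consists of paths, its legs, joined at the root. *)
Definition spider : Prop := forall x y, par x = par y -> par x != c -> x = y.

Lemma par_nroot x : par x != c -> x != c.
Proof. by apply: contraNneq => ->; rewrite par_root. Qed.

Lemma spider_iter_inj i x y :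
  spider -> iter i par x = iter i par y -> iter i par x != c -> x = y.
Proof.
move=> sp; elim: i => //= i IH E nc.
by have ixy := sp _ _ E nc; apply: IH => //; apply: par_nroot.
Qed.

Lemma weight_par x : spider -> par x != c -> weight (par x) = (weight x).+1.
Proof.
move=> sp pc; rewrite /weight -add1n.
have xc := par_nroot pc.
have -> : [set y | below y (par x)] = par x |: [set y | below y x].
  apply/setP => y; rewrite !inE; apply/idP/orP => [|[/eqP ->|yx]].
  - case/belowP=> [[|i]] /= E; [by left; rewrite E | right].
    by rewrite (sp x _ E pc) below_iter.
  - exact: below_refl.
  - exact: below_trans yx (below_par x).
by rewrite cardsU1 inE par_not_below.
Qed.

Lemma weight_iter i x : spider -> iter i par x != c ->
  weight (iter i par x) = weight x + i.
Proof.
move=> sp; elim: i => [|i IH] /= nc; first by rewrite addn0.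
by rewrite weight_par // IH ?addnS // par_nroot.
Qed.

(** Along a leg the weight starts at 1 in the leaf and grows by one per step. *)
Lemma spider_leaf x : spider -> x != c ->
  exists2 y, y \in level 0 & x = iter (weight x).-1 par y.
Proof.
move=> sp xc; have [y y0 /belowP[i E]] := leaf_exists xc; exists y => //.
have := @weight_iter i y sp; rewrite -E => /(_ xc) ->.
by move: y0; rewrite inE => /andP[_ /eqP ->].
Qed.

(** Climbing j steps is a bijection from the leaves deeper than j onto [level j]. *)
Lemma card_level_leaf j : spider ->
  #|level j| = #|[set y in level 0 | j < dist c y]|.
Proof.
move=> sp; rewrite -[RHS](@card_in_imset _ _ (iter j par)).
  apply: eq_card => x; apply/idP/imsetP => [|[y]].
    rewrite inE => /andP[xc /eqP wx]; have [y y0 E] := spider_leaf sp xc.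
    rewrite wx in E; exists y => //; rewrite inE y0 ltnNge -iter_root.
    by rewrite -E.
  rewrite !inE ltnNge -iter_root -andbA => /and3P[yc /eqP wy jc] ->.
  by rewrite jc weight_iter // wy add1n eqxx.
move=> x y; rewrite !inE => /andP[_ jx] _ /spider_iter_inj; apply=> //.
by rewrite iter_root -ltnNge.
Qed.

(** The level sizes thus determine how many legs have each length. *)
Lemma card_leaf_depth j : spider ->
  #|[set y in level 0 | dist c y == j.+1]| = #|level j| - #|level j.+1|.
Proof.
move=> sp; rewrite !card_level_leaf //.
rewrite -(cardsID [set y | dist c y == j.+1] [set y in level 0 | j < dist c y]).
set A := _ :&: _; set B := _ :\: _.
have -> : #|B| = #|[set y in level 0 | j.+1 < dist c y]|.
  by apply: eq_card => y; rewrite !inE; case: (y != c); case: (weight y == 1); lia.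
rewrite addnK; apply: eq_card => y; rewrite !inE.
by case: (y != c); case: (weight y == 1); lia.
Qed.

Lemma card_leaf_depth0 : [set y in level 0 | dist c y == 0] = set0.
Proof.
apply/setP => y; rewrite !inE; apply/negbTE/negP => /andP[/andP[yc _]].
by rewrite eqn0Ngt depth_gt0 yc.
Qed.

(* Equality in [upper_ge]; this characterizes T_{n,k}. *)
Definition profile : Prop := forall j, #|upper j| = #|G| - 1 - #|pendant G| * j.

(** Positivity at j + 1 means that neither of the two consecutive differences is truncated. *)
Lemma level_full j : profile -> 0 < #|upper j.+1| -> #|level j| = #|pendant G|.
Proof. by move=> pr; have := upperS j; rewrite !pr; nia. Qed.

(* If p has two children, then no vertex of weight [weight p - 1] is comparable
   with p, so a child of p enlarges the antichain of these vertices. *)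
Lemma profile_spider : profile -> spider.
Proof.
move=> pr x y; set p := par x => E pc; apply/eqP; apply: contraT => xy.
have xc : x != c := par_nroot pc.
have yc : y != c by apply: par_nroot; rewrite -E.
have xp : below x p by apply: below_par.
have yp : below y p by rewrite E; apply: below_par.
have px : ~~ below p x := par_not_below xc.
have py : ~~ below p y by rewrite E; apply: par_not_below yc.
have xNp : x != p by apply: contraNneq px => <-; apply: below_refl.
have [j wp] : exists j, weight p = j.+2.
  by exists (weight p).-2; have := weight_lt xp xNp; have := weight_gt0 x; lia.
have lj : #|level j| = #|pendant G|.
  by apply: level_full => //; apply/card_gt0P; exists p; rewrite inE pc wp /=.
have no_below a : a \in level j -> ~~ below a p.
  rewrite inE => /andP[ac /eqP wa]; apply/negP => ap.
  have aNp : a != p by apply/eqP => Eap; move: wa; rewrite Eap wp; lia.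
  have pNa : ~~ below p a.
    by apply: contra aNp => pa; apply/eqP/below_depth_eq => //; apply: below_depth.
  have child b : b != c -> par b = p -> below b a -> b = a.
    move=> bc Eb ba; apply/eqP; apply: contraT => bNa.
    by move: ba; rewrite below_neq // Eb (negbTE pNa).
  (* By [child], x and y cannot both lie below a. Then p and b, added to the vertices below a,
     exceed the weight of p. *)
  have [b bNa bp] : exists2 b, ~~ below b a & below b p /\ b != p.
    have [xa|xa] := boolP (below x a); last by exists x.
    exists y; last by split=> //; apply: contraNneq py => <-; apply: below_refl.
    apply/negP => ya; have ex := child x xc erefl xa.
    by have ey := child y yc (esym E) ya; rewrite ex ey eqxx in xy.
  suff : #|b |: (p |: [set z | below z a])| <= weight p.
    rewrite !cardsU1 !inE (negbTE pNa) (negbTE bNa) (negbTE (proj2 bp)) /=.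
    by rewrite -[#|_|]/(weight a) wa wp ltnn.
  apply/subset_leq_card/subsetP => z; rewrite !inE => /or3P[/eqP ->|/eqP ->|za].
  - by case: bp.
  - exact: below_refl.
  - exact: below_trans za ap.
have xNlj : x \notin level j by apply: contraL xp; apply: no_below.
have comp a : a \in level j -> ~~ below a x /\ ~~ below x a.
  move=> aj; split; apply/negP => ax.
    by have := no_below a aj; rewrite (below_trans ax xp).
  case/orP: (below_total ax xp) => [ap|]; first by have := no_below a aj; rewrite ap.
  by move/weight_le; move: aj; rewrite inE wp => /andP[_ /eqP ->]; rewrite ltnn.
have : antichain (x |: level j).
  have [cj acj] := level_antichain j.
  split; first by rewrite !inE eq_sym (negbTE xc) eqxx.
  move=> a b; rewrite !(in_setU1, in_setU) => /predU1P[->|aj] /predU1P[->|bj] //.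
  - by move=> ab; have [_] := comp b bj; rewrite ab.
  - by move=> ab; have [] := comp a aj; rewrite ab.
  - exact: acj.
by move/antichain_card; rewrite cardsU1 xNlj lj; lia.
Qed.

(** * The children of the root *)

Definition tops : {set G} := [set z | (z != c) && (par z == c)].

Lemma card_tops : #|tops| = degree c.
Proof. by apply: eq_card => z; rewrite !inE adjE eqxx. Qed.

Lemma topsE z : (z \in tops) = (dist c z == 1).
Proof. by rewrite inE -[par z]/(iter 1 par z) iter_root -depth_gt0; lia. Qed.


Lemma top_exists x : x != c -> exists2 z, z \in tops & below x z.
Proof.
move=> xc; exists (iter (dist c x).-1 par x); last exact: below_iter.
by rewrite topsE depth_iter; move: xc; rewrite -depth_gt0; lia.
Qed.

Lemma tops_eq z t : z \in tops -> t \in tops -> below z t -> z = t.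
Proof.
by rewrite !topsE => /eqP dz /eqP dt /below_depth_eq; apply; rewrite dz dt.
Qed.

(* Two children of a nonroot vertex could replace the vertex of [tops] above
   them, and would yield too large an antichain. *)
Lemma tops_spider : degree c = #|pendant G| -> spider.
Proof.
rewrite -card_tops => dc x y E pc; apply/eqP; apply: contraT => xy.
have xc := par_nroot pc.
have yc : y != c by apply: par_nroot; rewrite -E.
have [t tt pt] := top_exists pc.
have xt : below x t := below_trans (below_par x) pt.
have yt : below y t by apply: below_trans (below_par y) _; rewrite -E.
have dxy : dist c x = dist c y.
  have := depth_par x; rewrite E depth_par; move: xc yc; rewrite -!depth_gt0; lia.
have nxy a b : dist c a = dist c b -> below a b -> a = b.
  by move=> e /below_depth_eq; apply; rewrite e.
have xtop : x \notin tops by rewrite inE (negbTE pc) andbF.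
have ytop : y \notin tops by rewrite inE -E (negbTE pc) andbF.
pose A := x |: (y |: tops :\ t).
have cA : #|A| = #|tops|.+1.
  have := cardsD1 t tops.
  rewrite /A !cardsU1 !in_setU1 !in_setD1 (negbTE xtop) (negbTE ytop) (negbTE xy).
  by rewrite !andbF tt /=; lia.
(* If z were comparable with w, then z and t would be comparable, hence equal. *)
have sep_t z w : w != c -> z \in tops :\ t -> below w t -> ~~ below z w /\ ~~ below w z.
  move=> wc; rewrite in_setD1 => /andP[zt ztop] wt; split.
    apply: contra zt => zw; apply/eqP/tops_eq => //; exact: below_trans zw wt.
  apply: contra zt => wz; case/orP: (below_total wz wt) => zt.
    by rewrite (tops_eq ztop tt zt).
  by rewrite (tops_eq tt ztop zt).
have : antichain A.
  split.
    by rewrite !in_setU1 in_setD1 !(eq_sym c) (negbTE xc) (negbTE yc) inE eqxx andbF.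
  move=> a b /setU1P[->|/setU1P[->|aD]] /setU1P[->|/setU1P[->|bD]] //.
  - exact: nxy.
  - by move=> ab; have [_] := sep_t b x xc bD xt; rewrite ab.
  - exact: nxy.
  - by move=> ab; have [_] := sep_t b y yc bD yt; rewrite ab.
  - by move=> ab; have [] := sep_t a x xc aD xt; rewrite ab.
  - by move=> ab; have [] := sep_t a y yc aD yt; rewrite ab.
  - move: aD bD; rewrite !in_setD1 => /andP[_ at'] /andP[_ bt]; exact: tops_eq.
by move/antichain_card; rewrite cA -dc ltnn.
Qed.

(** There are k legs, each of length q or q + 1. So [level j] has k vertices for j < q, and
    [upper j] is empty for j > q, where the bound on n truncates the difference to 0. *)
Lemma tops_profile q :
  degree c = #|pendant G| ->
  #|G| - 1 < #|pendant G| * q.+1 ->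
  {in tops, forall z, (weight z == q) || (weight z == q.+1)} -> profile.
Proof.
move=> dc nq wt; have sp := tops_spider dc.
pose top y := iter (dist c y).-1 par y.
have leaf_depth y : y \in level 0 -> top y \in tops /\ dist c y = weight (top y).
  rewrite inE => /andP[yc /eqP wy].
  have tt : top y \in tops.
    by rewrite topsE depth_iter; move: yc; rewrite -depth_gt0; lia.
  split=> //; rewrite weight_iter //.
    by rewrite wy; move: yc; rewrite -depth_gt0; lia.
  by move: tt; rewrite inE => /andP[].
have card0 : #|level 0| = #|pendant G|.
  apply/eqP; rewrite eqn_leq (antichain_card (level_antichain 0)) -dc -card_tops /=.
  apply: leq_trans (leq_imset_card top _); apply/subset_leq_card/subsetP => z zt.
  have zc : z != c by move: zt; rewrite inE => /andP[].
  have [y y0 E] := spider_leaf sp zc; apply/imsetP; exists y => //.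
  move: zt; rewrite topsE {1}E depth_iter => /eqP dz.
  by rewrite {1}E /top; congr iter; lia.
have level_lt j : j < q -> #|level j| = #|pendant G|.
  move=> jq; rewrite card_level_leaf // -card0; apply: eq_card => y.
  rewrite inE andb_idr // => /leaf_depth[/wt wy ->].
  by case/orP: wy => /eqP ->; lia.
have upper_gt j : q < j -> #|upper j| = 0.
  move=> qj; apply/eqP; rewrite cards_eq0; apply/eqP/setP => x; rewrite in_set0 inE.
  apply/negbTE/negP => /andP[xc jx]; have [z /wt wz /weight_le xz] := top_exists xc.
  by move: wz; lia.
move=> j; case: (leqP j q) => [|qj]; last first.
  by rewrite upper_gt //; apply/esym/eqP; rewrite subn_eq0; nia.
elim: j => [|j IH] jq; first by rewrite upper0 muln0 subn0.
have := upperS j; rewrite IH 1?ltnW // level_lt //; nia.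
Qed.

(** * The Wiener index in terms of the sets [upper] *)

(** This makes [wiener_upper] applicable to the extremal tree. For w the weight of x, [upper w.-1]
    contains x, so k (w - 1) < n - 1, and k is at least 2. *)
Lemma profile_weight : 1 < #|pendant G| -> profile ->
  forall x, x != c -> (weight x).*2 <= #|G|.
Proof.
move=> k2 pr x xc.
have : 0 < #|upper (weight x).-1|.
  by apply/card_gt0P; exists x; rewrite inE xc /=; have := weight_gt0 x; lia.
by rewrite pr; have := weight_gt0 x; nia.
Qed.

Lemma wiener_upper : (forall x, x != c -> (weight x).*2 <= #|G|) ->
  wiener G = \sum_(j < #|G|) (#|G| - 1 - j.*2) * #|upper j|.
Proof.
move=> half; rewrite wiener_weight.
(* The increment of w (n - w) from j to j + 1 is n - 1 - 2j; the bound on w keeps it from being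
   truncated. *)
have mul_sum n w : w.*2 <= n -> w * (n - w) = \sum_(j < n) (j < w) * (n - 1 - j.*2).
  move=> wn; rewrite -(big_mkord xpredT (fun j => (j < w) * (n - 1 - j.*2))) /=.
  rewrite (big_cat_nat (n := w)) //=; last by lia.
  rewrite [X in _ + X]big_nat_cond [X in _ + X]big1 ?addn0; last first.
    by move=> i /andP[/andP[wi _] _]; rewrite ltnNge wi.
  elim: w wn => [|w IH] wn; first by rewrite big_nil.
  rewrite big_nat_recr //= ltnSn mul1n.
  rewrite (eq_big_nat _ _ (F2 := fun j => (j < w) * (n - 1 - j.*2))).
    by rewrite -IH; nia.
  by move=> i /andP[_ iw]; rewrite iw ltnS ltnW.
rewrite (eq_bigr _ (fun x xc => mul_sum _ _ (half x xc))) exchange_big /=.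
apply: eq_bigr => j _; rewrite -big_distrl /= mulnC; congr (_ * _).
rewrite -sum1dep_card [RHS]big_mkcondr /=; by apply: eq_bigr => x _; case: ltnP.
Qed.

End Rooted.

(** Take c minimizing the sum of distances to all vertices. Moving to a child z adds n and subtracts
    twice the weight of z, so minimality bounds the weights of children, and hence all others. *)
Lemma centroid_exists (G : sgraph) : is_tree G -> exists c par,
  rooting c par /\ forall x : G, x != c -> (weight par x).*2 <= #|G|.
Proof.
move=> tG; have [conG _] := tG; have /card_gt0P[c0 _] := proj1 conG.
have [c _ cmin] := arg_minnP (fun c : G => \sum_(u : G) dist u c) (isT : xpredT c0).
have [par rt] := tree_rooting c tG; exists c, par; split=> // x xc.
have [z] := top_exists conG rt xc; rewrite inE => /andP[zc /eqP pz] /weight_le.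
rewrite -leq_double; move/leq_trans; apply.
have : \sum_(u : G) dist u z + (weight par z).*2 = \sum_(u : G) dist u c + #|G|.
  rewrite -sum1_card -big_split /=.
  have -> : weight par z = \sum_(u : G) below par u z.
    by rewrite /weight -sum1dep_card big_mkcond; apply: eq_bigr => u _; case: ifP.
  rewrite -mul2n big_distrr -big_split; apply: eq_bigr => u _ /=.
  by rewrite !(distE conG rt) mul2n (sep_par conG rt) // pz addn1.
by have := cmin z isT; lia.
Qed.

(** * Isomorphism invariance and isomorphisms of spiders *)

Lemma dist_iso_le (G H : sgraph) (f : G -> H) x y : connected G ->
  (forall x y, adj (f x) (f y) = adj x y) -> dist (f x) (f y) <= dist x y.
Proof.
move=> [_ conG] fadj; have [p [xp <- <-]] := dist_walk (conG x y).
rewrite -(size_map f); apply: dist_le; last by rewrite last_map.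
by rewrite path_map; apply: sub_path xp => a b; rewrite /= fadj.
Qed.

Lemma wiener_iso (G H : sgraph) :
  connected G -> connected H -> iso G H -> wiener G = wiener H.
Proof.
move=> conG conH [f [[g fK gK] fadj]]; apply: double_inj; rewrite !wiener_double //.
have gadj x y : adj (g x) (g y) = adj x y by rewrite -fadj !gK.
rewrite [RHS](reindex f) /=; last by exists g => x _.
apply: eq_bigr => x _; rewrite [RHS](reindex f) /=; last by exists g => y _.
apply: eq_bigr => y _; apply/eqP; rewrite eqn_leq dist_iso_le // andbT.
by rewrite -{1}(fK x) -{1}(fK y) dist_iso_le.
Qed.

(** Equal level sizes give equally many legs of each length; leaves are matched by depth and the
    matching is extended up the legs. *)
Lemma spider_iso (G H : sgraph) (c : G) (par : G -> G) (c' : H) (par' : H -> H) :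
  connected G -> connected H -> rooting c par -> rooting c' par' ->
  spider c par -> spider c' par' -> #|G| = #|H| ->
  (forall j, #|level c par j| = #|level c' par' j|) -> iso G H.
Proof.
move=> conG conH rt rt' sp sp' cardGH lev.
pose LG d := [set y in level c par 0 | dist c y == d].
pose LH d := [set y in level c' par' 0 | dist c' y == d].
have cardL d : #|LG d| = #|LH d|.
  case: d => [|d]; first by rewrite /LG /LH !card_leaf_depth0 // !cards0.
  by rewrite (card_leaf_depth conG rt) // (card_leaf_depth conH rt') // !lev.
(* A leaf goes to the leaf at the same position among those of the same depth. *)
pose sg y := nth c' (enum (LH (dist c y))) (index y (enum (LG (dist c y)))).
have sgP y : y \in level c par 0 ->
    sg y \in level c' par' 0 /\ dist c' (sg y) = dist c y.
  move=> y0; have : sg y \in LH (dist c y).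
    rewrite -mem_enum mem_nth // -cardE -cardL cardE index_mem mem_enum.
    by rewrite inE y0 eqxx.
  by rewrite inE => /andP[-> /eqP].
have sg_inj : {in level c par 0 &, injective sg}.
  move=> x y x0 y0 E; have exy : dist c x = dist c y.
    by have [_ <-] := sgP x x0; have [_ <-] := sgP y y0; rewrite E.
  have inL z : z \in level c par 0 -> z \in enum (LG (dist c z)).
    by move=> z0; rewrite mem_enum inE z0 eqxx.
  have xL : x \in enum (LG (dist c y)) by rewrite -exy inL.
  have yL := inL y y0.
  move/eqP: E; rewrite /sg exy nth_uniq ?enum_uniq -?cardE -?cardL ?cardE ?index_mem //.
  by move/eqP/(congr1 (nth c (enum (LG (dist c y))))); rewrite !nth_index.
pose leaf x :=
  odflt c [pick y | (y \in level c par 0) && (iter (weight par x).-1 par y == x)].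
have leafP x : x != c ->
    leaf x \in level c par 0 /\ iter (weight par x).-1 par (leaf x) = x.
  move=> xc; rewrite /leaf; case: pickP => [y /andP[y0 /eqP] //|no].
  by have [y y0 E] := spider_leaf conG rt sp xc; have := no y; rewrite y0 -E eqxx.
(* The height of x above the leaf of its leg is its weight minus one. *)
pose F x := if x == c then c' else iter (weight par x).-1 par' (sg (leaf x)).
have depthF x : dist c' (F x) = dist c x.
  rewrite /F; case: eqVneq => [->|xc]; first by rewrite !dist_refl.
  have [l0 E] := leafP x xc; have [_ ds] := sgP _ l0.
  by rewrite (depth_iter rt') ds -[in RHS]E (depth_iter rt).
have FN x : (F x != c') = (x != c).
  by rewrite -(depth_gt0 _ conH) depthF depth_gt0.
have weightF x : x != c -> weight par' (F x) = weight par x.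
  move=> xc; have := FN x; rewrite xc /F (negbTE xc) => Fc.
  have [l0 _] := leafP x xc; have [s0 _] := sgP _ l0.
  rewrite (weight_iter conH rt') //; move: s0; rewrite inE => /andP[_ /eqP ->].
  by rewrite add1n prednK // weight_gt0.
have F_inj : injective F.
  move=> x y E; have [xc|xc] := eqVneq x c.
    apply/esym/eqP; rewrite xc; apply: contraT; rewrite -FN -E.
    by rewrite FN xc eqxx.
  have yc : y != c by rewrite -FN -E FN.
  have ew : weight par x = weight par y by rewrite -!weightF // E.
  have [lx ex] := leafP x xc; have [ly ey] := leafP y yc.
  have := FN x; rewrite xc => Fc; move: E Fc.
  rewrite /F (negbTE xc) (negbTE yc) ew => /(spider_iter_inj rt' sp') inj /inj.
  by move/(sg_inj _ _ lx ly) => el; rewrite -ex -ey el ew.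
have Fpar x : F (par x) = par' (F x).
  have [->|xc] := eqVneq x c.
    by rewrite (par_root rt) /F eqxx (par_root rt').
  have [pc|pc] := eqVneq (par x) c.
    rewrite pc {1}/F eqxx; apply/esym/eqP; apply: contraT.
    by rewrite -(depth_gt0 _ conH) (depth_par rt') depthF -(depth_par rt) pc dist_refl.
  have wp := weight_par conG rt sp pc.
  have el : leaf (par x) = leaf x.
    have [lp ep] := leafP _ pc; have [lx ex] := leafP _ xc.
    move: ep; rewrite wp /= -{3}ex -iterS prednK ?weight_gt0 // => ep.
    apply: (spider_iter_inj rt sp ep).
    by rewrite ep -(prednK (weight_gt0 par x)) iterS ex.
  rewrite /F (negbTE pc) (negbTE xc) el wp -iterS prednK ?weight_gt0 //.
exists F; split; first by apply: inj_card_bij => //; rewrite cardGH.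
by move=> x y; rewrite (adjE rt') (adjE rt) -!Fpar !FN !(inj_eq F_inj).
Qed.

(** * The components left after deleting the centre *)

Lemma path_graph_embed_connect (H : sgraph) (m : nat) (e : path_graph m -> H) :
  (forall a b, adj a b -> adj (e a) (e b)) ->
  forall a b, connect (@adj H) (e a) (e b).
Proof.
move=> eadj; have csym : connect_sym (@adj H) by apply/sym_connect_sym/adj_sym.
have up d (a b : 'I_m) : b = a + d :> nat -> connect (@adj H) (e a) (e b).
  elim: d b => [|d IH] b E.
    by rewrite (_ : b = a) ?connect0 //; apply: val_inj; rewrite /= E addn0.
  have lt : a + d < m by rewrite -addnS -E ltnW // ltn_ord.
  apply: (connect_trans (IH (Ordinal lt) erefl)); apply/connect1/eadj.
  by rewrite /= /path_rel /= E addnS eqxx.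
move=> a b; case/orP: (leq_total a b) => le.
  by apply: (up (b - a)); rewrite subnKC.
by rewrite csym; apply: (up (a - b)); rewrite subnKC.
Qed.

Section TwoPaths.
Variables r s a b : nat.
Let H := disjoint_union (copies r (path_graph a)) (copies s (path_graph b)).

Definition same_copy (x y : H) : bool :=
  match x, y with
  | inl u, inl v | inr u, inr v => u.1 == v.1
  | _, _ => false
  end.

Lemma same_copy_adj x y : adj x y -> same_copy x =1 same_copy y.
Proof. by case: x y => [u|u] [v|v] //= /andP[/eqP uv _] [w|w] //=; rewrite uv. Qed.

Lemma same_copy_connect x y : same_copy x y -> connect (@adj H) x y.
Proof.
case: x y => [[i u]|[i u]] [[j v]|[j v]] //= /eqP <-.
  apply: (@path_graph_embed_connect H a (fun w => inl (i, w))) => w z /= wz.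
  by rewrite /copies_rel eqxx.
apply: (@path_graph_embed_connect H b (fun w => inr (i, w))) => w z /= wz.
by rewrite /copies_rel eqxx.
Qed.

Lemma card_same_copy x : (#|same_copy x| == a) || (#|same_copy x| == b).
Proof.
case: x => [[i u]|[i u]]; apply/orP; [left | right].
  rewrite -[X in _ == X]card_ord -(@card_imset _ _ (fun w => inl (i, w) : H)).
    apply/eqP/eq_card => y; rewrite unfold_in.
    apply/idP/imsetP => [|[w _ ->] /=]; last by rewrite eqxx.
    by case: y => [[j w]|[j w]] //= /eqP <-; exists w.
  by move=> w z [].
rewrite -[X in _ == X]card_ord -(@card_imset _ _ (fun w => inr (i, w) : H)).
  apply/eqP/eq_card => y; rewrite unfold_in.
  apply/idP/imsetP => [|[w _ ->] /=]; last by rewrite eqxx.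
  by case: y => [[j w]|[j w]] //= /eqP <-; exists w.
by move=> w z [].
Qed.

(** The vertices below z form the component of z in the graph without c: the climb from such a
    vertex to z avoids c, and a walk can leave them only through the edge from z to c. *)
Lemma tops_weight (G : sgraph) (c : G) (par : G -> G) z :
  connected G -> rooting c par -> iso (delete_vertex c) H -> z \in tops c par ->
  (weight par z == a) || (weight par z == b).
Proof.
move=> conG rt [f [[g fK gK] fadj]]; rewrite inE => /andP[zc /eqP pz].
pose Z : delete_vertex c := exist _ z zc.
suff -> : weight par z = #|same_copy (f Z)| by apply: card_same_copy.
have vg_inj : injective (fun h : H => val (g h)).
  by move=> h h' /val_inj/(can_inj gK).
rewrite -(card_imset _ vg_inj); apply: eq_card => y; rewrite inE.
apply/idP/imsetP => [yz|[h hz ->]].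
  suff [h hz <-] : exists2 h, same_copy (f Z) h & val (g h) = y by exists h.
  have [i E] := belowP yz.
  elim: i y E {yz} => [|i IH] y E.
    exists (f Z); last by rewrite fK.
    by case: (f Z) => u /=.
  rewrite iterSr in E.
  have [h hz ph] := IH _ E.
  have pc : par y != c by rewrite -ph; apply: (valP (g h)).
  have yc := par_nroot rt pc.
  pose Y : delete_vertex c := exist _ y yc; exists (f Y); last by rewrite fK.
  have : adj h (f Y).
    rewrite -[h]gK fadj /= /delete_rel /= ph (adjE rt) yc eqxx /=.
    by rewrite orbT.
  have sc_sym u v : same_copy u v = same_copy v u.
    by case: u v => [u|u] [v|v] //=; rewrite eq_sym.
  by move/same_copy_adj/(_ (f Z)); rewrite !(sc_sym _ (f Z)) => <-.
have /connectP[p] := same_copy_connect hz.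
elim/last_ind: p h {hz} => [|p h' IH] h /=; first by move=> _ ->; rewrite fK below_refl.
rewrite rcons_path last_rcons => /andP[pp ad] ->.
have bl := IH _ pp erefl; move: bl; set h1 := last (f Z) p in ad *.
have : adj (g h1) (g h') by rewrite -fadj !gK.
rewrite /= /delete_rel; set u := val (g h1); set w := val (g h') => uw bl.
suff: below par w z by [].
have wc : w != c := valP (g h').
move: uw; rewrite (adjE rt) => /orP[/andP[uc /eqP uw]|/andP[_ /eqP wu]].
  have [E|uz] := eqVneq u z; first by rewrite -uw E pz eqxx in wc.
  by rewrite -uw -below_neq.
by apply: below_trans (below_par par w) _; rewrite wu.
Qed.

End TwoPaths.

(** * The extremal tree and the comparison *)

Lemma Tnk_profile (n k : nat) (S : sgraph) : 0 < k -> is_Tnk n k S ->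
  exists c par, rooting c par /\ profile (c : S) par.
Proof.
move=> k0 [[tS cardS pS] [c [dc isoS]]]; have [conS _] := tS.
have [par rt] := tree_rooting c tS; exists c, par; split=> //.
apply: (tops_profile conS rt (q := (n - 1) %/ k)); rewrite ?pS ?cardS //.
  by rewrite mulnC ltn_ceil.
by move=> z /(tops_weight conS rt isoS); rewrite orbC.
Qed.

(** Both trees are spiders, and their level sizes, as differences of consecutive [upper] sizes,
    depend only on n and k. *)
Lemma profile_iso (G H : sgraph) (c : G) par (c' : H) par' :
  connected G -> connected H -> rooting c par -> rooting c' par' ->
  profile c par -> profile c' par' ->
  #|G| = #|H| -> #|pendant G| = #|pendant H| -> iso G H.
Proof.
move=> conG conH rt rt' pr pr' cGH pGH.
apply: (spider_iso conG conH rt rt') => //; try exact: profile_spider.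
have levelE (K : sgraph) (d : K) qar : profile d qar ->
    forall j, #|level d qar j| = #|upper d qar j| - #|upper d qar j.+1|.
  by move=> _ j; rewrite upperS addnK.
by move=> j; rewrite !levelE // !pr !pr' cGH pGH.
Qed.

Theorem theorem1p3 (n k : nat) (hk : 2 <= k <= n - 2)
    (S : sgraph) (hS : is_Tnk n k S) (T : sgraph) (hT : tree_class n k T) :
  wiener S <= wiener T /\ (wiener S = wiener T <-> iso T S).
Proof.
have [k2 _] := andP hk; have k0 : 0 < k by apply: ltnW.
have [[[conS _] cardS pS] _] := hS; have [tT cardT pT] := hT; have [conT _] := tT.
have [c [par [rt pr]]] := Tnk_profile k0 hS.
have [c' [par' [rt' half]]] := centroid_exists tT.
have WS : wiener S = \sum_(j < n) (n - 1 - j.*2) * (n - 1 - k * j).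
  rewrite (wiener_upper conS rt) ?cardS; last first.
    by rewrite -cardS; apply: profile_weight => //; rewrite pS.
  by apply: eq_bigr => j _; rewrite pr cardS pS.
have WT : wiener T = \sum_(j < n) (n - 1 - j.*2) * #|upper c' par' j|.
  by rewrite (wiener_upper conT rt') ?cardT // -cardT.
have ge j : n - 1 - k * j <= #|upper c' par' j|.
  by rewrite -cardT -pT; apply: upper_ge.
have ge_term (j : 'I_n) (_ : true) : (n - 1 - j.*2) * (n - 1 - k * j) <=
    (n - 1 - j.*2) * #|upper c' par' j| by rewrite leq_mul2l ge orbT.
have le : wiener S <= wiener T by rewrite WS WT; apply: leq_sum.
split=> //; split=> [E|]; last first.
  by move/(wiener_iso conT conS) ->.
apply: (profile_iso conT conS rt' rt) => //; rewrite ?pT ?cardT //.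
move=> j; rewrite cardT pT.
(* When 2j is at least n - 1 the coefficient vanishes and equality of the sums gives no information,
   but both sides are 0: no weight exceeds n/2, and k is at least 2. *)
have [nj|nj] := leqP (n - 1) j.*2.
  have -> : #|upper c' par' j| = 0.
    apply/eqP; rewrite cards_eq0; apply/eqP/setP => x; rewrite in_set0 inE.
    by apply/negbTE/negP => /andP[/half]; rewrite cardT; lia.
  by apply/esym/eqP; rewrite subn_eq0; nia.
have jn : j < n by lia.
(* Equal sums of termwise ordered families agree term by term, and here the coefficient is positive
   and cancels. *)
have := leqif_sum (fun i (_ : true) => leqif_eq (ge_term i isT)).
rewrite -WS -WT => -[_]; rewrite E eqxx => /esym/forallP/(_ (Ordinal jn)).
by rewrite /= eqn_pmul2l ?subn_gt0 // => /eqP.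
Qed.
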